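(* Let $D=\mathbb{Q}\mathbb{U}_1$ be the rational Urysohn sphere and let $$K(D)=\{f\in[0,1]^D:\ |f(x)-f(y)|\le d(x,y)\le f(x)+f(y)\ \text{for all }x,y\in D\}.$$ Let $A=\{a_0,a_1,a_2\}\subset D$ with $d(a_i,a_j)=1$ for $i\ne j$, and put $r(x)=\min_{0\le i\le 2}d(x,a_i)$ for $x\in D$. Then the function $$f_A(x)=\min\{1,\tfrac12+r(x)\}\qquad(x\in D)$$ is an extreme point of $K(D)$.
   Context: The rational Urysohn sphere $\mathbb{Q}\mathbb{U}_1$ is the (unique up to isometry) countable metric space $(D,d)$ with rational distances, of diameter one, with the following extension property: for every finite $F\subset D$ and every map $p:F\to\mathbb{Q}\cap[0,1]$ with $|p(x)-p(y)|\le d(x,y)\le p(x)+p(y)$ for all $x,y\in F$, there is $z\in D$ with $d(z,x)=p(x)$ for all $x\in F$. $K(D)$ is a compact convex subset of $[0,1]^D$. *)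

(* Defs.v *)
From HB Require Import structures.
From mathcomp Require Import all_boot all_order all_algebra.
From mathcomp Require Import all_classical all_reals all_analysis.

Set Implicit Arguments.
Unset Strict Implicit.
Unset Printing Implicit Defensive.

Import Order.TTheory GRing.Theory Num.Theory.
Import numFieldNormedType.Exports.

Local Open Scope classical_set_scope.
Local Open Scope ring_scope.
Local Open Scope convex_scope.

Definition extreme_point (R : numDomainType) (M : lmodType R)
    (A : set (convex_lmodType M)) (x : convex_lmodType M) : Prop :=
  A x /\
  forall (y z : convex_lmodType M) (t : {i01 R}),
    A y -> A z -> 0 < t%:num < 1 -> x = y <| t |> z -> y = x /\ z = x.

(* A map on a finite F is a total map whose values outside F are irrelevant.
   Since sup defaults to 0, sup = 1 also says that the distances are bounded. *)
Definition rational_urysohn_sphere (R : realType) (D : metricType R) : Prop :=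
  [/\ countable [set: D],
      forall x y : D, exists q : rat, mdist x y = ratr q,
      sup [set mdist xy.1 xy.2 | xy in [set: D * D]] = 1
    & forall (F : set D) (p : D -> rat), finite_set F ->
        (forall x, F x -> 0 <= p x <= 1) ->
        (forall x y, F x -> F y ->
           `|ratr (p x) - ratr (p y)| <= mdist x y <= ratr (p x) + ratr (p y)) ->
        exists z : D, forall x, F x -> mdist z x = ratr (p x)].

Definition katetov (R : realType) (D : metricType R) : set (D -> R^o) :=
  [set f | (forall x, 0 <= f x <= 1) /\
           (forall x y, `|f x - f y| <= mdist x y <= f x + f y)].

Definition dist_to (R : realType) (D : metricType R) (a : 'I_3 -> D) (x : D) : R :=
  \big[Num.min/mdist x (a ord0)]_(i < 3) mdist x (a i).

Definition f_A (R : realType) (D : metricType R) (a : 'I_3 -> D) : D -> R^o :=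
  fun x => Num.min 1 (2^-1 + dist_to a x).

(* Main.v *)
Require Import Defs.
From HB Require Import structures.
From mathcomp Require Import all_boot all_order all_algebra.
From mathcomp Require Import all_classical all_reals all_analysis.
From mathcomp Require Import lra.
Import Order.TTheory GRing.Theory Num.Theory.
Import numFieldNormedType.Exports.
Local Open Scope classical_set_scope.
Local Open Scope ring_scope.

(** Each value of [f_A] is forced by constraints of [K(D)] that are tight at
    [f_A], and a constraint tight at a proper convex combination is tight at
    both ends.  The sums over pairs of [A] force the value [1/2] on [A], which
    has three points; where [f_A x < 1], the Lipschitz constraint between [x]
    and a nearest [a_i] forces [1/2 + r x]; elsewhere the bound [f x <= 1] is
    tight. *)

(** The weighted slacks [t * (c - u)] and [(1 - t) * (c - v)] are nonnegative and sum to zero, so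
    both vanish. *)
Lemma conv_le_tight (R : realFieldType) (t u v c : R) :
  0 < t < 1 -> u <= c -> v <= c -> t * u + (1 - t) * v = c -> u = c /\ v = c.
Proof.
move=> /andP[t0 t1] uc vc e.
have ucE : t * (c - u) + (1 - t) * (c - v) = 0 by lra.
have hu : 0 <= t * (c - u) by rewrite mulr_ge0 ?subr_ge0// ltW.
have hv : 0 <= (1 - t) * (c - v) by rewrite mulr_ge0 ?subr_ge0// ltW.
have [/eqP hu0 /eqP hv0] : t * (c - u) = 0 /\ (1 - t) * (c - v) = 0.
  by split; lra.
move: hu0 hv0; rewrite !mulf_eq0 !subr_eq0 (gt_eqF t0) (gt_eqF t1) /=.
by move=> /eqP-> /eqP->.
Qed.

Lemma mdist_le1 (R : realType) (D : metricType R) (x y : D) :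
  sup [set mdist xy.1 xy.2 | xy in [set: D * D]] = 1 -> mdist x y <= 1.
Proof.
move=> s1; rewrite -s1; apply: sup_upper_bound; last by exists (x, y).
(* Without a supremum, [sup] would take its default value 0, not 1. *)
by apply: contrapT => /sup_out; rewrite s1; apply/eqP; rewrite oner_eq0.
Qed.

Section dist_to_three_points.
Context {R : realType} {D : metricType R}.
Implicit Types (a : 'I_3 -> D) (x y : D).

Lemma dist_to_le a x i : dist_to a x <= mdist x (a i).
Proof. exact: bigmin_le. Qed.

Lemma dist_to_attained a x : exists i, dist_to a x = mdist x (a i).
Proof.
suff [i le_i] : exists i, mdist x (a i) <= dist_to a x.
  by exists i; apply/eqP; rewrite eq_le dist_to_le.
have : dist_to a x <= dist_to a x by [].
by case/bigmin_leP=> [|[i _]]; [exists ord0 | exists i].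
Qed.

Lemma dist_to_ge0 a x : 0 <= dist_to a x.
Proof. by have [i ->] := dist_to_attained a x; exact: mdist_ge0. Qed.

Lemma dist_to_center a i : dist_to a (a i) = 0.
Proof.
by apply/eqP; rewrite eq_le dist_to_ge0 andbT -(mdistxx (a i)) dist_to_le.
Qed.

Lemma dist_to_lip a x y : dist_to a x <= mdist x y + dist_to a y.
Proof.
have [i ->] := dist_to_attained a y.
exact: le_trans (dist_to_le a x i) (metric_triangle _ _ _).
Qed.

Lemma f_A_center a i : f_A a (a i) = 2^-1.
Proof. by rewrite /f_A dist_to_center addr0 min_r//; lra. Qed.

(** Truncating at 1 keeps the 1-Lipschitz bound of [dist_to]; all values are at least 1/2, so any
    two sum to at least 1, which bounds every distance. *)
Lemma f_A_katetov a : (forall x y, mdist x y <= 1) -> katetov (f_A a).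
Proof.
move=> d1; split=> [x|x y]; rewrite /f_A.
  have := dist_to_ge0 a x; rewrite /Num.min; case: ifP => *; lra.
have := dist_to_ge0 a x; have := dist_to_ge0 a y; have := d1 x y.
have := dist_to_lip a x y; have := dist_to_lip a y x; rewrite (metric_sym y x).
have := mdist_ge0 x y; rewrite ler_norml /Num.min.
by case: ltP => ?; case: ltP => ? *; lra.
Qed.

(** Stated for a single [g] so that it applies to each end of a segment through [f_A a]. *)
Lemma f_A_determined a (g : D -> R^o) :
  (forall i j : 'I_3, i != j -> g (a i) + g (a j) = 1) ->
  (forall x i, f_A a x - f_A a (a i) = mdist x (a i) ->
     g x - g (a i) = mdist x (a i)) ->
  (forall x, f_A a x = 1 -> g x = 1) ->
  g = f_A a.
Proof.
move=> gpair glip gone.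
have ga i : g (a i) = 2^-1.
  (* Adding the equations for 01 and 02 and subtracting the one for 12 leaves
     [2 * g (a ord0) = 1]. *)
  have h01 := gpair ord0 (lift ord0 ord0) isT.
  have h02 := gpair ord0 ord_max isT.
  have h12 := gpair (lift ord0 ord0) ord_max isT.
  have h0 : g (a ord0) = 2^-1 by lra.
  have [->//|i0] := eqVneq i ord0; have := gpair i ord0 i0; lra.
apply/funext => x; have [i ri] := dist_to_attained a x.
have [r1|r1] := leP 1 (2^-1 + dist_to a x).
  by have f1 : f_A a x = 1 := min_l r1; rewrite f1 gone.
have fx : f_A a x = 2^-1 + dist_to a x := min_r (ltW r1).
have := glip x i; rewrite f_A_center ga fx ri addrC addKr => /(_ erefl); lra.
Qed.

End dist_to_three_points.

Theorem proposition7p2 (R : realType) (D : metricType R)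
    (hD : rational_urysohn_sphere D)
    (a : 'I_3 -> D)
    (ha : forall i j : 'I_3, i != j -> mdist (a i) (a j) = 1) :
  extreme_point (@katetov R D) (f_A a).
Proof.
have [_ _ supD _] := hD.
split=> [|y z t [y01 yK] [z01 zK] t01 fE].
  by apply: f_A_katetov => x y; exact: mdist_le1.
have {}fE x : t%:num * y x + (1 - t%:num) * z x = f_A a x.
  by rewrite fE.
have pairs i j : i != j -> y (a i) + y (a j) = 1 /\ z (a i) + z (a j) = 1.
  move=> ij; have := yK (a i) (a j); have := zK (a i) (a j); rewrite (ha _ _ ij).
  move=> /andP[_ hz] /andP[_ hy].
  have := fE (a i); have := fE (a j); rewrite !f_A_center => ej ei.
  (* The pair sums are bounded below by 1, so they are negated to fit an upper bound; it is tight
     because [f_A a] is 1/2 at both centers. *)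
  have [] := @conv_le_tight R t%:num (- (y (a i) + y (a j)))
    (- (z (a i) + z (a j))) (-1) t01; [lra..|split; lra].
have lips x i : f_A a x - f_A a (a i) = mdist x (a i) ->
    y x - y (a i) = mdist x (a i) /\ z x - z (a i) = mdist x (a i).
  (* Only one side of the absolute value bound is tight here, the upper bound on the signed
     difference. *)
  rewrite -!fE => e; apply: (@conv_le_tight R t%:num) => //; last lra.
    by have /andP[/ler_normlP[_]] := yK x (a i).
  by have /andP[/ler_normlP[_]] := zK x (a i).
have ones x : f_A a x = 1 -> y x = 1 /\ z x = 1.
  rewrite -fE => e; apply: (@conv_le_tight R t%:num) => //.
    by have /andP[] := y01 x.
  by have /andP[] := z01 x.
by split; apply: f_A_determined => [i j /pairs[]|x i /lips[]|x /ones[]].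
Qed.
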